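(* Let $n\ge 2$ and suppose $d_1\le d_2\le\dots\le d_n$. The determinant of the resultant complex provides a determinantal formula for the resultant $\mathrm{Res}_{d_1,\dots,d_n}(f_1,\dots,f_n)$ (i.e. for some integer $t\ge 0$) if and only if $$d_3+\dots+d_n-n<d_1+d_2-1 .$$ Moreover, when this inequality holds, there exists a determinantal formula given by the resultant complex for each integer $t\ge 0$ such that $$d_3+\dots+d_n-n<t<d_1+d_2 .$$
   Context: Let $d_1,\dots,d_n\ge 1$ be integers and $t_n:=\sum_{i=1}^n(d_i-1)$. Let $f_i=\sum_{|\alpha|=d_i}a_{i,\alpha}X^\alpha$ ($i=1,\dots,n$) be generic homogeneous polynomials of degree $d_i$ in $X=(X_1,\dots,X_n)$, and $A=\mathbb{Z}[a_{i,\alpha}]$ the polynomial ring in all their coefficients. $\mathrm{Res}_{d_1,\dots,d_n}(f_1,\dots,f_n)\in A$ is the multivariate resultant. Bezoutian: with $Y=(Y_1,\dots,Y_n)$ put $$\Delta_{ij}(X,Y)=\frac{f_i(Y_1,\dots,Y_{j-1},X_j,\dots,X_n)-f_i(Y_1,\dots,Y_j,X_{j+1},\dots,X_n)}{X_j-Y_j},$$ $$\Delta(X,Y)=\det(\Delta_{ij}(X,Y))=\sum_{|\gamma|\le t_n}\Delta_\gamma(X)Y^\gamma .$$ $S_u$ is the free $A$-module on the monomials of degree $u$ in $A[X]$ ($S_u=0$ if $u<0$), $\{T_\gamma\}$ the basis of $S_u^*$ dual to $\{X^\gamma\}$, and $\psi_{1,t}:S_{t_n-t}^*\to S_t$, $T_\gamma\mapsto\Delta_\gamma(X)$.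 Resultant complex in degree $t$ ($t\ge0$ an integer): let $K(t)^{-j}=\bigoplus_{i_1<\dots<i_j}S_{t-d_{i_1}-\cdots-d_{i_j}}$ with Koszul morphisms $\delta_{-j}:K(t)^{-(j+1)}\to K(t)^{-j}$, and let $K(t_n-t)^{j}=\bigoplus_{i_1<\dots<i_j}S^*_{t_n-t-d_{i_1}-\cdots-d_{i_j}}$ with the dual Koszul morphisms $\delta^*_j:K(t_n-t)^j\to K(t_n-t)^{j+1}$. The resultant complex is $$0\to C^{-n}\to\cdots\to C^{-1}\xrightarrow{\partial_0}C^0\to\cdots\to C^{n-1}\to 0$$ with $C^{-j}=K(t)^{-j}$ ($j=2,\dots,n$), $C^j=K(t_n-t)^{j+1}$ ($j=1,\dots,n-1$), $C^{-1}=S_{t_n-t}^*\oplus\bigoplus_iS_{t-d_i}$, $C^0=S_t\oplus\bigoplus_iS_{t_n-t-d_i}^*$, with $\partial_0(T,g)=(\psi_{1,t}(T)+\sum_ig_if_i,\ \delta_0^*(T))$ and all other maps given by the Koszul morphisms (extended by $0$ on the additional summands). Its determinant (with respect to monomial bases) equals $\mathrm{Res}_{d_1,\dots,d_n}(f_1,\dots,f_n)$ up to sign. The determinant of the resultant complex in degree $t$ is said to provide a determinantal formula when the complex reduces to the single map $\partial_0:C^{-1}\to C^0$, that is, precisely when $C^{-2}=C^1=0$ (so that $\partial_0$ is given by a square matrix whose determinant is $\pm\mathrm{Res}_{d_1,\dots,d_n}(f_1,\dots,f_n)$). *)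

(* Defs.v *)
From HB Require Import structures.
From mathcomp Require Import all_boot all_order all_algebra.
From mathcomp Require Import mpoly.

Set Implicit Arguments.
Unset Strict Implicit.
Unset Printing Implicit Defensive.

Import Order.TTheory GRing.Theory Num.Theory.
Local Open Scope ring_scope.

(** * Free modules with a finite basis, and cochain complexes *)

Definition free_mod (R : comNzRingType) (B : finType) : lmodType R :=
  {ffun B -> R^o}.

(* [lin_of c] sends the basis vector [b] to [\sum_b' c b b' b']. *)
Definition lin_of (R : comNzRingType) (B B' : finType) (c : B -> B' -> R)
    (x : free_mod R B) : free_mod R B' :=
  [ffun b' => \sum_b (x b : R) * c b b'].

Lemma lin_of_is_linear (R : comNzRingType) (B B' : finType)
  (c : B -> B' -> R) : linear (lin_of c).
Proof.
move=> a x y; apply/ffunP=> b'; rewrite !ffunE /=.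
rewrite /GRing.scale /= mulr_sumr -big_split /=; apply: eq_bigr => b _.
by rewrite !ffunE mulrDl mulrA.
Qed.

HB.instance Definition _ (R : comNzRingType) (B B' : finType)
    (c : B -> B' -> R) :=
  GRing.isLinear.Build R (free_mod R B) (free_mod R B') _ (lin_of c)
    (lin_of_is_linear c).

Record cochain_complex (R : comNzRingType) := CochainComplex {
  term :> int -> lmodType R;
  differential : forall k : int, {linear term k -> term (k + 1)};
  differential_comp : forall (k : int) (x : term k),
    differential (k + 1) (differential k x) = 0 }.

Definition zero_term (R : comNzRingType) (C : cochain_complex R) (k : int) :=
  forall x : C k, x = 0.

(* [C] reduces to the single map [C^{-1} -> C^0]. *)
Definition reduces_to_single_map (R : comNzRingType) (C : cochain_complex R) :=
  forall k : int, k != -1 -> k != 0 -> zero_term C k.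

(** * Monomials of a given integral degree *)

(* The type is empty when [u < 0], so that [S_u = 0] in that case. *)
Definition mon (n : nat) (u : int) : finType :=
  {m : 'X_{1..n < `|u|.+1} | (mdeg m)%:Z == u}.

Definition monval (n : nat) (u : int) (m : mon n u) : 'X_{1..n} :=
  bmnm (val m).

Lemma mon_deg (n : nat) (u : int) (m : mon n u) : (mdeg (monval m))%:Z = u.
Proof. by apply/eqP; case: m. Qed.

(** * The Bezoutian *)

Section Bezoutian.
Variables (R : comNzRingType) (n : nat).
Implicit Types (p : {mpoly R[n]}) (f : 'I_n -> {mpoly R[n]}).

(* [R[X][Y]]: the outer variables are the [Y]s, the inner ones the [X]s. *)
Notation RXY := {mpoly {mpoly R[n]}[n]}.

Definition varX (j : 'I_n) : RXY := ('X_j)%:MP.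
Definition varY (j : 'I_n) : RXY := 'X_j.
Definition cstXY (c : R) : RXY := c%:MP%:MP.

(* [p (Y_1, .., Y_k, X_{k+1}, .., X_n)]: the first [k] variables of [p] are
   specialized to the [Y]s. *)
Definition mixed (k : nat) p : RXY :=
  mmap cstXY (fun l : 'I_n => if (l < k)%N then varY l else varX l) p.

(* The exact quotient of [mixed j p - mixed j.+1 p] by [X_j - Y_j], see
   [bez_entryP]. *)
Definition bez_entry p (j : 'I_n) : RXY :=
  \sum_(m <- msupp p) cstXY p@_m *
    ((\prod_(l < n | (l < j)%N) varY l ^+ m l) *
     (\prod_(l < n | (j < l)%N) varX l ^+ m l) *
     (\sum_(k < m j) varX j ^+ ((m j).-1 - k) * varY j ^+ k)).

Lemma bez_entryP p (j : 'I_n) :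
  (varX j - varY j) * bez_entry p j = mixed j p - mixed j.+1 p.
Proof.
rewrite /bez_entry /mixed /mmap mulr_sumr -sumrB; apply: eq_bigr => m _.
rewrite mulrCA -mulrBr; congr (_ * _); rewrite mulrCA /mmap1.
rewrite [X in _ = X - _](bigD1 j) //= [X in _ = _ - X](bigD1 j) //=.
rewrite ltnn ltnSn.
have E (k : nat) : (k == j :> nat) || (k == j.+1) ->
  \prod_(i < n | i != j) (if (i < k)%N then varY i else varX i) ^+ m i =
  (\prod_(l < n | (l < j)%N) varY l ^+ m l) * (\prod_(l < n | (j < l)%N) varX l ^+ m l).
  move=> hk; rewrite (bigID (fun l : 'I_n => (l < j)%N)) /=; congr (_ * _).
    apply: eq_big => [l|l /andP[_ lj]].
      by case: (ltnP l j) => lj; rewrite ?andbF ?andbT // neq_ltn lj.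
    suff -> : (l < k)%N by [].
    by case/orP: hk => /eqP ->; rewrite // ltnS ltnW.
  apply: eq_big => [l|l]; first by rewrite -leqNgt ltn_neqAle eq_sym.
  rewrite -leqNgt => /andP[lj jl].
  have {}jl : (j < l)%N by rewrite ltn_neqAle eq_sym lj.
  suff /negPf -> : ~~ (l < k)%N by [].
  by rewrite -leqNgt; case/orP: hk => /eqP ->; rewrite // ltnW.
rewrite !E ?eqxx ?orbT // -mulrBl subrXX [LHS]mulrC mulrC; congr (_ * _).
Qed.

Definition bezoutian f : RXY := \det (\matrix_(i, j) bez_entry (f i) j).

(* [\Delta_\gamma(X)], the coefficient of [Y^\gamma]. *)
Definition bez_coef f (g : 'X_{1..n}) : {mpoly R[n]} := (bezoutian f)@_g.

End Bezoutian.

(** * The resultant complex of a homogeneous system *)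

Section ResultantComplex.
Variables (R : comNzRingType) (n : nat) (d : 'I_n -> nat).
Variable f : 'I_n -> {mpoly R[n]}.
Hypothesis f_homog : forall i, f i \is (d i).-homog.

Definition t_crit : int := \sum_(i < n) ((d i)%:Z - 1).

Definition degI (I : {set 'I_n}) : int := \sum_(i in I) (d i)%:Z.

(* The monomial basis of [K(v)^{-j}], the direct sum over [#|I| = j] of
   [S_{v - \sum_(i in I) d i}].  It also indexes the dual basis of [K(v)^j]. *)
Definition kos_basis (v : int) (j : nat) : finType :=
  {I : {I : {set 'I_n} | #|I| == j} & mon n (v - degI (val I))}.

Definition kset v j (b : kos_basis v j) : {set 'I_n} := val (tag b).
Definition kmon v j (b : kos_basis v j) : 'X_{1..n} := monval (tagged b).

Definition kos_sign (I : {set 'I_n}) (i : 'I_n) : R :=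
  (-1) ^+ #|[set k in I | (k < i)%N]|.

(* The coefficient at [b'] of the image of [b] by the Koszul map
   [X^m e_I |-> \sum_(i in I) (-1)^#{k in I, k < i} f_i X^m e_{I \ i}]. *)
Definition kos_coef v j j' (b : kos_basis v j) (b' : kos_basis v j') : R :=
  \sum_(i in kset b | kset b :\ i == kset b')
     kos_sign (kset b) i * (f i * 'X_[kmon b])@_(kmon b').

(* The matrix of the dual Koszul map, in the dual bases. *)
Definition dual_kos_coef v j j' (b : kos_basis v j) (b' : kos_basis v j') : R :=
  kos_coef b' b.

(* [\psi_{1,t} (T_\gamma) = \Delta_\gamma], which is homogeneous of degree [t]
   for [\gamma] of degree [t_crit - t]. *)
Definition bez_map_coef u v (b : kos_basis u 0) (b' : kos_basis v 0) : R :=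
  (bez_coef f (kmon b))@_(kmon b').

Variable t : int.

(* [Negz j] is [- (j + 1)]; [S_v] is [K(v)^0]. *)
Definition res_basis (k : int) : finType :=
  match k with
  | Negz j.+1 => kos_basis t j.+2
  | Negz 0 => (kos_basis (t_crit - t) 0 + kos_basis t 1)%type
  | Posz 0 => (kos_basis t 0 + kos_basis (t_crit - t) 1)%type
  | Posz j.+1 => kos_basis (t_crit - t) j.+2
  end.

(* The blocks of the differentials; only the case [k' = k + 1] is used. *)
Definition res_coef (k k' : int) : res_basis k -> res_basis k' -> R :=
  match k, k' return res_basis k -> res_basis k' -> R with
  | Negz j.+1, Negz j'.+1 => fun b b' => kos_coef b b'
  | Negz j.+1, Negz 0 => fun b b' =>
      match b' with
      | inl _ => 0
      | inr g => kos_coef b g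
      end
  | Negz 0, Posz 0 => fun b b' =>
      match b, b' with
      | inl T, inl g => bez_map_coef T g
      | inr g, inl g' => kos_coef g g'
      | inl T, inr T' => dual_kos_coef T T'
      | inr _, inr _ => 0
      end
  | Posz 0, Posz j'.+1 => fun b b' =>
      match b with
      | inl _ => 0
      | inr T => dual_kos_coef T b'
      end
  | Posz j.+1, Posz j'.+1 => fun b b' => dual_kos_coef b b'
  | _, _ => fun _ _ => 0
  end.

Definition res_term (k : int) : lmodType R := free_mod R (res_basis k).

Lemma sum_mon_coef (u : int) (q g : {mpoly R[n]}) (m : 'X_{1..n}) :
  (forall mu, mu \in msupp q -> (mdeg mu)%:Z = u) ->
  \sum_(mu : mon n u) q@_(monval mu) * (g * 'X_[monval mu])@_m = (g * q)@_m.
Proof.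
move=> hq; have hk : (msize q <= `|u|.+1)%N.
  rewrite mmeasureE; apply/bigmax_leqP_seq => mu mu_q _.
  by rewrite ltnS -(hq _ mu_q).
rewrite [in RHS](mpolywE hk) mulr_sumr raddf_sum /=.
rewrite [RHS](bigID (fun mu : 'X_{1..n < `|u|.+1} => (mdeg mu)%:Z == u)) /=.
rewrite [X in _ = _ + X]big1 ?addr0; last first.
  move=> mu /negP hmu; rewrite (memN_msupp_eq0 (p := q)) ?scale0r ?mulr0 ?mcoeff0 //.
  by apply/negP => mu_q; apply: hmu; rewrite (hq _ mu_q).
rewrite [RHS](reindex_omap (val : mon n u -> 'X_{1..n < `|u|.+1}) insub) /=;
  last by move=> mu hmu; rewrite insubT.
apply: eq_big => [mu|mu _]; first by rewrite valK eqxx (valP mu).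
by rewrite -scalerAr mcoeffZ.
Qed.

Lemma sum_kos_coef v j (I : {set 'I_n}) (q g : {mpoly R[n]}) (m : 'X_{1..n}) :
  #|I| = j -> (forall mu, mu \in msupp q -> (mdeg mu)%:Z = v - degI I) ->
  \sum_(b : kos_basis v j | kset b == I)
    q@_(kmon b) * (g * 'X_[kmon b])@_m = (g * q)@_m.
Proof.
move=> /eqP cI hq; pose I0 : {I : {set 'I_n} | #|I| == j} := exist _ I cI.
rewrite -(sum_mon_coef _ _ hq).
pose F (J : {I : {set 'I_n} | #|I| == j}) (mu : mon n (v - degI (val J))) :=
  q@_(monval mu) * (g * 'X_[monval mu])@_m.
transitivity (\sum_(J | J == I0) \sum_(mu : mon n (v - degI (val J))) F J mu).
  by rewrite sig_big_dep /=; apply: eq_bigl => b; rewrite andbT.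
by rewrite big_pred1_eq.
Qed.

Lemma kos_sign_anti (I : {set 'I_n}) (i l : 'I_n) :
  i \in I -> (i < l)%N ->
  kos_sign I l * kos_sign (I :\ l) i = - (kos_sign I i * kos_sign (I :\ i) l).
Proof.
move=> iI il; rewrite /kos_sign.
have -> : [set k in I :\ l | (k < i)%N] = [set k in I | (k < i)%N].
  apply/setP=> k; rewrite !inE; case: (eqVneq k l) => //= ->.
  by rewrite ltnNge ltnW // andbF.
have -> : [set k in I :\ i | (k < l)%N] = [set k in I | (k < l)%N] :\ i.
  by apply/setP=> k; rewrite !inE andbA.
rewrite (cardsD1 i [set k in I | (k < l)%N]) inE iI il /= exprS.
by rewrite mulN1r mulNr mulrC.
Qed.

Lemma kos_comp v j j' j'' (b : kos_basis v j) (b'' : kos_basis v j'') :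
  \sum_(b' : kos_basis v j') kos_coef b b' * kos_coef b' b'' = 0.
Proof.
pose I := kset b; pose I'' := kset b''.
pose Q i l := (f l * (f i * 'X_[kmon b]))@_(kmon b'').
have cI : #|I| = j by apply/eqP; case: b @I @Q => [[]].
transitivity (\sum_(i in I) \sum_(l in I :\ i | I :\ i :\ l == I'')
    kos_sign I i * kos_sign (I :\ i) l *
    (\sum_(b' : kos_basis v j' | kset b' == I :\ i)
      (f i * 'X_[kmon b])@_(kmon b') * (f l * 'X_[kmon b'])@_(kmon b''))).
  under eq_bigr do rewrite /kos_coef mulr_suml.
  under eq_bigr do rewrite big_mkcondr.
  rewrite exchange_big /=; apply: eq_bigr => i iI.
  under [RHS]eq_bigr do rewrite mulr_sumr.
  rewrite exchange_big /= [RHS]big_mkcond /=.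
  rewrite [RHS]big_mkcond; apply: eq_bigr => b' _ /=; rewrite eq_sym.
  case: eqP => [->|//]; rewrite mulr_sumr; apply: eq_bigr => l _.
  by rewrite -!mulrA; congr (_ * _); rewrite mulrCA.
have [jE|jN] := eqVneq j j'.+1; last first.
  apply: big1 => i iI; apply: big1 => l _.
  rewrite big_pred0 ?mulr0 // => b'; apply/negP => /eqP b'E.
  have cb' : #|kset b'| = j' by apply/eqP; case: (b') => [[]].
  by move: jN; rewrite -cI (cardsD1 i) iI -b'E cb' eqxx.
transitivity (\sum_(p : 'I_n * 'I_n | [&& p.1 \in I, p.2 \in I, p.1 != p.2 &
      I :\ p.1 :\ p.2 == I'']) kos_sign I p.1 * kos_sign (I :\ p.1) p.2 * Q p.1 p.2).
  rewrite pair_big_dep; apply: eq_big => [[i l]|[i l] /= /andP[iI _]] /=.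
    by rewrite !inE [l == i]eq_sym; case: (i \in I) => //=; case: (l \in I);
      rewrite ?andbT ?andbF.
  congr (_ * _); apply: sum_kos_coef.
    by apply/eqP; rewrite -eqSS -jE -cI (cardsD1 i I) iI.
  have Xh : ('X_[kmon b] : {mpoly R[n]}) \is (mdeg (kmon b)).-homog.
    by rewrite dhomogX.
  have /dhomogP hfX := dhomogM (f_homog i) Xh; move=> mu /hfX ->.
  rewrite PoszD mon_deg -/(kset b) -/I /degI (big_setD1 i iI) /=.
  by rewrite addrCA opprD addNKr.
rewrite (bigID (fun p : 'I_n * 'I_n => (p.1 < p.2)%N)) /=.
pose sw (p : 'I_n * 'I_n) := (p.2, p.1).
rewrite [X in _ + X](reindex_inj (h := sw)) /=; last by case=> [? ?] [? ?] [-> ->].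
rewrite -[X in X + _]opprK -sumrN; apply/eqP; rewrite addrC subr_eq0; apply/eqP.
have setDC (i l : 'I_n) : I :\ i :\ l = I :\ l :\ i.
  by apply/setP=> k; rewrite !inE andbCA.
apply: eq_big => [[i l]|[i l]] /=.
  rewrite setDC [l == i]eq_sym -leqNgt ltn_neqAle.
  rewrite (inj_eq val_inj).
  by case: (eqVneq i l) => [->|il]; rewrite ?andbF //= andbCA.
rewrite -leqNgt => /andP[/and4P[lI iI li _] il].
have {}il : (i < l)%N by rewrite ltn_neqAle (inj_eq val_inj) eq_sym li.
by rewrite (kos_sign_anti iI il) mulNr /Q mulrCA.
Qed.

Lemma dual_kos_comp v j j' j'' (b : kos_basis v j) (b'' : kos_basis v j'') :
  \sum_(b' : kos_basis v j') dual_kos_coef b b' * dual_kos_coef b' b'' = 0.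
Proof.
rewrite -[RHS](kos_comp j' b'' b); apply: eq_bigr => b' _; exact: mulrC.
Qed.

Lemma res_coef_comp k k' k'' (b : res_basis k) (b'' : res_basis k'') :
  \sum_(b' : res_basis k') res_coef b b' * res_coef b' b'' = 0.
Proof.
case: k b => [[|j]|[|j]] b; case: k' => [[|j']|[|j']]; case: k'' b'' => [[|j'']|[|j'']] b'' /=;
  try (by apply: big1 => b' _; rewrite ?mul0r ?mulr0);
  try exact: kos_comp; try exact: dual_kos_comp;
  rewrite ?big_sumType /=.
- case: b => [T|T]; last exact: dual_kos_comp.
  by apply: big1 => b' _; rewrite mul0r.
- rewrite [X in X + _]big1 ?add0r; last by move=> b' _; rewrite mulr0.
  case: b => [T|g]; first exact: dual_kos_comp.
  by apply: big1 => b' _; rewrite mul0r.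
- rewrite [X in X + _]big1 ?add0r; last by move=> b' _; rewrite mul0r.
  case: b'' => [g|T]; first exact: kos_comp.
  by apply: big1 => b' _; rewrite mulr0.
- case: b'' => [T|g]; last exact: kos_comp.
  by apply: big1 => b' _; rewrite mulr0.
Qed.

Definition res_diff (k : int) : {linear res_term k -> res_term (k + 1)} :=
  lin_of (@res_coef k (k + 1)).

Lemma res_diff_comp (k : int) (x : res_term k) :
  res_diff (k + 1) (res_diff k x) = 0.
Proof.
apply/ffunP=> b''; rewrite /res_diff !ffunE /=.
under eq_bigr do rewrite ffunE mulr_suml.
rewrite exchange_big big1 //= => b _.
under eq_bigr do rewrite -mulrA.
by rewrite -mulr_sumr res_coef_comp mulr0.
Qed.

Definition resultant_complex_of : cochain_complex R :=
  CochainComplex res_diff_comp.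

End ResultantComplex.

(** * The generic system *)

Section Generic.
Variables (n : nat) (d : 'I_n -> nat).

(* The indeterminates [a_{i,alpha}], with [|alpha| = d_i]. *)
Definition coef_index : finType := {i : 'I_n & mon n (d i)}.

Definition coef_ring : comNzRingType := {mpoly int[#|coef_index|]}.

Definition gen_coef (i : 'I_n) (alpha : mon n (d i)) : coef_ring :=
  'X_(enum_rank (Tagged (fun i => mon n (d i)) alpha : coef_index)).

Definition gen_poly (i : 'I_n) : {mpoly coef_ring[n]} :=
  \sum_(alpha : mon n (d i)) gen_coef alpha *: 'X_[monval alpha].

Lemma gen_poly_homog (i : 'I_n) : gen_poly i \is (d i).-homog.
Proof.
apply: rpred_sum => alpha _; apply: rpredZ; rewrite dhomogX.
by apply/eqP; have [] := mon_deg alpha.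
Qed.

Definition resultant_complex (t : nat) : cochain_complex coef_ring :=
  resultant_complex_of gen_poly_homog t.

(* The determinant of the resultant complex in degree [t] provides a
   determinantal formula for the resultant. *)
Definition determinantal_formula (t : nat) : Prop :=
  reduces_to_single_map (resultant_complex t).

End Generic.

(* Main.v *)
Require Import Defs.
From mathcomp Require Import all_boot all_order all_algebra.
From mathcomp Require Import mpoly.
From mathcomp Require Import zify.

Import Order.TTheory GRing.Theory Num.Theory.
Local Open Scope ring_scope.

(** The term of the Koszul complex of degree [v] indexed by subsets of size [j]
    is free on pairs of a [j]-subset [I] and a monomial of degree
    [v - \sum_(i in I) d i], so it vanishes exactly when [v] is smaller than
    every such sum. As the degrees are nonnegative and sorted, every subset
    of size at least [2] has degree at least [d_1 + d_2], with equality for the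
    first two indices ([kos_basis_deg], [kos_basis2_inh]). Hence the left
    part of the resultant complex vanishes iff [t < d_1 + d_2], and the right
    part, a dual Koszul complex of degree [t_n - t], vanishes iff
    [t_n - t < d_1 + d_2], which says [d_3 + .. + d_n - n < t]. This is
    [determinantal_formulaP]; it remains to see when the open interval between
    [d_3 + .. + d_n - n] and [d_1 + d_2] contains a natural number. *)

Lemma free_mod_zeroP (R : comNzRingType) (B : finType) :
  (forall x : free_mod R B, x = 0) <-> (B -> False).
Proof.
split=> [z b|B0 x]; last by apply/ffunP=> b; case: (B0 b).
pose x : free_mod R B := [ffun=> 1].
by have /eqP := congr1 (fun y : free_mod R B => y b) (z x);
  rewrite !ffunE oner_eq0.
Qed.

Lemma mon_inh (n : nat) (i : 'I_n) (u : int) : 0 <= u -> inhabited (mon n u).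
Proof.
case: u => // u _.
have hu : (mdeg (U_(i) *+ u)%MM < `|u%:Z|.+1)%N by rewrite mdegMn mdeg1 mul1n.
by apply: inhabits; exists (BMultinom hu); rewrite /= mdegMn mdeg1 mul1n.
Qed.

Section SortedDegrees.
Variables (n : nat) (hn : (2 <= n)%N) (d : 'I_n -> nat).
Hypothesis d_sorted : forall i j : 'I_n, (i <= j)%N -> (d i <= d j)%N.

Let i1 := Ordinal (ltnW hn).
Let i2 := Ordinal hn.

Lemma degI_ge (I : {set 'I_n}) :
  (2 <= #|I|)%N -> (d i1)%:Z + (d i2)%:Z <= degI d I.
Proof.
case/card_gt1P=> i [l [iI lI]].
wlog il : i l iI lI / (i < l)%N => [H ne|_].
  have := ne; rewrite -(inj_eq val_inj) /= neq_ltn => /orP[] lt.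
    exact: (H i l).
  by apply: (H l i) => //; rewrite eq_sym.
rewrite /degI (big_setD1 i) //= (big_setD1 l) /=; last first.
  by rewrite !inE lI -(inj_eq val_inj) /= neq_ltn il orbT.
rewrite addrA; apply: ler_wpDr; first exact: sumr_ge0.
apply: lerD; rewrite lez_nat; apply: d_sorted => //.
exact: leq_ltn_trans il.
Qed.

Lemma kos_basis_deg (v : int) (j : nat) :
  kos_basis d v j.+2 -> (d i1)%:Z + (d i2)%:Z <= v.
Proof.
case=> [[I /= cI] m]; have := mon_deg m.
have : (2 <= #|I|)%N by rewrite (eqP cI).
by move=> /degI_ge /=; lia.
Qed.

Lemma kos_basis2_inh (v : int) :
  (d i1)%:Z + (d i2)%:Z <= v -> inhabited (kos_basis d v 2).
Proof.
move=> hv; have c12 : #|[set i1; i2]| == 2 by rewrite cards2.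
have [|m] := mon_inh n i1 (v - degI d [set i1; i2]).
  by rewrite /degI big_setU1 ?inE //= big_set1 subr_ge0.
by apply: inhabits; exists (exist _ [set i1; i2] c12).
Qed.

Lemma t_critE :
  t_crit d = (d i1)%:Z + (d i2)%:Z
             + (\sum_(i < n | (2 <= i)%N) (d i)%:Z - n%:Z).
Proof.
rewrite /t_crit sumrB sumr_const card_ord natz addrA; congr (_ - _).
rewrite (bigD1 i1) //= (bigD1 i2) //= !addrA; congr (_ + _).
apply: eq_bigl => i; rewrite -!(inj_eq val_inj) /=.
by case: (val i) => [|[|k]].
Qed.

Lemma determinantal_formulaP (t : nat) :
  determinantal_formula d t <->
  \sum_(i < n | (2 <= i)%N) (d i)%:Z - n%:Z < t%:Z < (d i1)%:Z + (d i2)%:Z.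
Proof.
split=> [zt|/andP[lo hi] k kN1 k0].
  apply/andP; split; rewrite ltNge; apply/negP=> le.
    have [|b] := kos_basis2_inh (t_crit d - t%:Z); first by rewrite t_critE; lia.
    exact: (proj1 (free_mod_zeroP _ _) (zt 1 isT isT) b).
  have [b] := kos_basis2_inh _ le.
  (* [Negz 1] is the cohomological degree [-2]. *)
  exact: (proj1 (free_mod_zeroP _ _) (zt (Negz 1) isT isT) b).
apply/free_mod_zeroP.
case: k kN1 k0 => [[|j]|[|j]] //= _ _ /kos_basis_deg; last by lia.
by rewrite t_critE; lia.
Qed.

End SortedDegrees.

Theorem lemma5p3 (n : nat) (hn : (2 <= n)%N) (d : 'I_n -> nat)
  (d_ge1 : forall i : 'I_n, (1 <= d i)%N)
  (d_sorted : forall i j : 'I_n, (i <= j)%N -> (d i <= d j)%N) :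
  let d1 : int := (d (Ordinal (ltnW hn)))%:Z in
  let d2 : int := (d (Ordinal hn))%:Z in
  let s : int := \sum_(i < n | (2 <= i)%N) (d i)%:Z - n%:Z in
  ((exists t : nat, determinantal_formula d t) <-> s < d1 + d2 - 1) /\
  (s < d1 + d2 - 1 ->
     forall t : nat, s < t%:Z -> t%:Z < d1 + d2 -> determinantal_formula d t).
Proof.
move=> d1 d2 s; have P := determinantal_formulaP n hn d d_sorted.
split; last by move=> _ t lo hi; apply/P/andP.
split=> [[t /P]|lt_s]; first by rewrite -/d1 -/d2 -/s; lia.
have := d_ge1 (Ordinal hn).
(* The least natural number above [s] is [max 0 (s + 1)]. *)
have [s_lt0|s_ge0] := ltP s 0 => d2_gt0.
  by exists 0; apply/P; rewrite -/d1 -/d2 -/s; lia.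
by exists `|s|%N.+1; apply/P; rewrite -/d1 -/d2 -/s; lia.
Qed.
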